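(* Let $n>3$ be an integer, and let $G$ and $H$ be finite digraphs with maximum degree less than $n$. Then there exists a $\mathbb{Z}_n$-flow-continuous mapping $E(G)\to E(H)$ if and only if there exists a $\mathbb{Z}$-flow-continuous mapping $E(G)\to E(H)$.
   Context: Digraphs are finite multidigraphs; loops and parallel edges are allowed. For an abelian group $M$, a map $\varphi:E(G)\to M$ is an $M$-flow if at every vertex $v$ the sum of $\varphi$ over edges leaving $v$ equals the sum of $\varphi$ over edges entering $v$. A mapping $f:E(G)\to E(H)$ is $M$-flow-continuous if for every $M$-flow $\varphi$ on $H$ the composition $\varphi\circ f$ is an $M$-flow on $G$. *)

(* Defs.v *)
From HB Require Import structures.
From mathcomp Require Import all_boot all_order all_algebra.

Set Implicit Arguments.
Unset Strict Implicit.
Unset Printing Implicit Defensive.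

Import GRing.Theory.

Local Open Scope ring_scope.

Record digraph := Digraph {
  vertex : finType;
  edge : finType;
  source : edge -> vertex;
  target : edge -> vertex
}.

(* Degree in the underlying undirected multigraph; a loop counts twice. *)
Definition degree (G : digraph) (v : vertex G) : nat :=
  (#|[set e : edge G | source e == v]| + #|[set e : edge G | target e == v]|)%N.

Definition max_degree (G : digraph) : nat := (\max_(v : vertex G) degree v)%N.

Definition is_flow (M : zmodType) (G : digraph) (phi : edge G -> M) : Prop :=
  forall v : vertex G,
    \sum_(e | source e == v) phi e = \sum_(e | target e == v) phi e.

Definition flow_continuous (M : zmodType) (G H : digraph)
    (f : edge G -> edge H) : Prop :=
  forall phi : edge H -> M, is_flow phi -> is_flow (phi \o f).

(* Main.v *)
(* Every flow with values in an abelian group M is an M-combination of the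
   fundamental cycles of a spanning forest, which are integer flows with values
   in {-1, 0, 1}. Hence Z-flow-continuity implies M-flow-continuity of the same
   mapping. Conversely, if f is Z_n-flow-continuous, the pullback along f of a
   fundamental cycle has at each vertex a net flow divisible by n and, since
   the degree is less than n, of absolute value less than n. *)

Require Import Defs.
From HB Require Import structures.
From mathcomp Require Import all_boot all_order all_algebra.
From mathcomp Require Import zify.

Set Implicit Arguments.
Unset Strict Implicit.
Unset Printing Implicit Defensive.

Import Order.TTheory GRing.Theory Num.Theory.

Local Open Scope ring_scope.

Local Notation root := fingraph.root.

Section Boundary.
Variable G : digraph.
Implicit Types (e g : edge G) (v x y : vertex G).

Definition boundary (c : edge G -> int) v : int :=
  \sum_(g | target g == v) c g - \sum_(g | source g == v) c g.

Lemma is_flow_boundary (c : edge G -> int) : is_flow c <-> forall v, boundary c v = 0.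
Proof.
split=> [cF v | c0 v]; first by rewrite /boundary cF subrr.
by apply/eqP; rewrite eq_sym -subr_eq0; apply/eqP/c0.
Qed.

Lemma boundaryD (c d : edge G -> int) v :
  boundary (fun g => c g + d g) v = boundary c v + boundary d v.
Proof. by rewrite /boundary !big_split opprD addrACA. Qed.

Lemma boundaryN (c : edge G -> int) v : boundary (fun g => - c g) v = - boundary c v.
Proof. by rewrite /boundary !sumrN opprD. Qed.

Definition edge_chain e g : int := (g == e)%:R.

Lemma boundary_edge_chain e v :
  boundary (edge_chain e) v = (target e == v)%:R - (source e == v)%:R.
Proof.
by rewrite /boundary; congr (_ - _); rewrite big_mkcond (bigD1 e) //=
  /edge_chain eqxx big1 ?addr0 => [|g /negPf->]; case: ifP.
Qed.

Definition joined : rel (vertex G) := fun x y =>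
  [exists e, (source e == x) && (target e == y)
          || (source e == y) && (target e == x)].

Lemma joined_sym : symmetric joined.
Proof. by move=> x y; apply: eq_existsb => e; rewrite orbC. Qed.

Lemma connect_joined_sym : connect_sym joined.
Proof. exact: sym_connect_sym joined_sym. Qed.

Lemma root_edge e : root joined (source e) = root joined (target e).
Proof.
apply/(fingraph.rootP connect_joined_sym)/connect1/existsP.
by exists e; rewrite !eqxx.
Qed.

(* A forest inside [X]: [s e] is nonzero exactly for the forest edges and then
   gives their orientation away from the root, and [c x] is the signed
   forest path from the root of [x] to [x]. *)
Record forest_paths (X : {set vertex G}) (c : vertex G -> edge G -> int)
    (s : edge G -> int) : Prop := ForestPaths {
  forest_boundary : forall x v, x \in X ->
    boundary (c x) v = (x == v)%:R - (root joined x == v)%:R;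
  forest_sign : forall e, `|s e| <= 1;
  forest_support : forall x e, x \in X -> (c x e == 0) || (c x e == s e);
  forest_mem : forall e, s e != 0 -> (source e \in X) && (target e \in X);
  forest_step : forall e, s e != 0 ->
    forall g, c (target e) g = c (source e) g + edge_chain e g }.

(** The edgeless forest with one vertex per component, from which the spanning forest is grown. *)
Lemma forest_paths_roots :
  forest_paths [set x | root joined x == x] (fun _ _ => 0) (fun=> 0).
Proof.
split=> // x v; rewrite inE => /eqP->.
by rewrite /boundary !big1_eq !subrr.
Qed.

(** Growth by a pendant edge: the path to [y] is the path to [x] followed by [e], with [z] the sign
    with which [e] is traversed from [x] to [y]. *)
Lemma forest_paths_extend X c s x y e (z : int) :
    forest_paths X c s -> x \in X -> y \notin X ->
    ((z, source e, target e) = (1, x, y)) \/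
    ((z, source e, target e) = (-1, y, x)) ->
  forest_paths (y |: X)
    (fun u => if u == y then fun g => c x g + z * edge_chain e g else c u)
    (fun g => if g == e then z else s g).
Proof.
move=> [bd sg sup mem step] xX yX ends.
have zE : z = 1 \/ z = -1 by case: ends => [[->]|[->]]; [left|right].
(* Forest edges have both ends in [X], so [e] is not one yet and the existing paths avoid it. *)
have se0 : s e = 0.
  apply/eqP/negPn/negP => /mem /andP[].
  by case: ends => [[_ _ ->] _|[_ -> _]]; rewrite (negPf yX).
have ce0 u : u \in X -> c u e = 0.
  by move=> /(sup u e); rewrite se0 orbb => /eqP.
have neqy u : u \in X -> (u == y) = false.
  by move=> uX; apply: contraNF yX => /eqP<-.
have rxy : root joined x = root joined y.
  by have := root_edge e; case: ends => [[_ -> ->]|[_ -> ->]].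
split.
- move=> u v; rewrite !inE; case: eqVneq => [-> _ | _ /=]; last exact: bd.
  rewrite boundaryD bd // rxy.
  have -> : boundary (fun g => z * edge_chain e g) v = z * boundary (edge_chain e) v.
    by rewrite /boundary -!mulr_sumr mulrBr.
  rewrite boundary_edge_chain.
  by case: ends => [[-> -> ->]|[-> -> ->]]; lia.
- by move=> g; case: eqP => // _; case: zE => ->.
- move=> u g; rewrite !inE; case: eqVneq => [-> _ | _ /= uX].
    rewrite /edge_chain; case: (eqVneq g e) => [->|_].
      by rewrite ce0 // add0r mulr1 eqxx orbT.
    by rewrite mulr0 addr0 sup.
  by case: (eqVneq g e) => [->|_]; [rewrite (ce0 u) | apply: sup].
- move=> g; case: (eqVneq g e) => [-> _ | _ /mem /andP[]]; rewrite !inE.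
    by case: ends => [[_ -> ->]|[_ -> ->]]; rewrite eqxx xX ?orbT.
  by move=> -> ->; rewrite !orbT.
move=> g; case: (eqVneq g e) => [-> _ h | _ sg0 h].
  case: ends => [[-> -> ->]|[-> -> ->]]; rewrite eqxx neqy // ?mul1r //.
  by rewrite mulN1r addrNK.
by have /andP[sX tX] := mem _ sg0; rewrite !neqy // step.
Qed.

(** Edges leaving [X] are added one at a time, by induction on a bound for the number of vertices
    still missing. *)
Lemma forest_paths_setT : exists c s, forest_paths setT c s.
Proof.
suff ext n X c s : (#|~: X| <= n)%N -> [set x | root joined x == x] \subset X ->
    forest_paths X c s -> exists c s, forest_paths setT c s.
  exact: ext (leqnn _) (subxx _) forest_paths_roots.
elim: n X c s => [|n IHn] X c s leXn rX fX.
  have -> : setT = X; last by exists c, s.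
  by rewrite -(setCK X); move: leXn; rewrite leqn0 cards_eq0 => /eqP->; rewrite setC0.
(* If no edge leaves [X], then [X] is a union of components; containing every root, it is the whole
   vertex set. *)
have [clX | ] := boolP [forall x in X, forall y, joined x y ==> (y \in X)].
  have -> : setT = X; last by exists c, s.
  apply/esym/eqP; rewrite eqEsubset subsetT; apply/subsetP => y _.
  have {}clX : closed joined (mem X).
    apply: (intro_closed connect_joined_sym) => u v uv uX.
    by have /forall_inP/(_ u uX)/forallP/(_ v)/implyP/(_ uv) := clX.
  rewrite (closed_connect clX (connect_root joined y)).
  apply: (subsetP rX); rewrite inE.
  exact: (roots_root connect_joined_sym).
rewrite negb_forall_in => /exists_inP[x xX]; rewrite negb_forall.
case/existsP=> y; rewrite negb_imply => /andP[/existsP[e exy] yX].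
have [z ends] : exists z : int, ((z, source e, target e) = (1, x, y)) \/
    ((z, source e, target e) = (-1, y, x)).
  case/orP: exy => /andP[/eqP-> /eqP->]; first by exists 1; left.
  by exists (-1); right.
apply: IHn (forest_paths_extend fX xX yX ends).
  rewrite -ltnS; apply: leq_trans leXn; apply/proper_card/properP.
  split; first by rewrite setCS subsetUr.
  by exists y; rewrite !inE ?eqxx.
by rewrite (subset_trans rX) // subsetUr.
Qed.

(* [psi e] is the fundamental cycle of [e] with respect to a spanning forest,
   and zero if [e] belongs to the forest. *)
Lemma fundamental_flows : exists psi : edge G -> edge G -> int,
  [/\ forall e, is_flow (psi e), forall e g, `|psi e g| <= 1 &
      forall (M : zmodType) (phi : edge G -> M), is_flow phi ->
        forall g, phi g = \sum_e phi e *~ psi e g].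
Proof.
have [c [s [bd sg sup mem step]]] := forest_paths_setT.
(* The closed walk from the root to the source of [e], across [e], and back to the root; the shared
   part of the two paths cancels. *)
exists (fun e g => edge_chain e g + (c (source e) g + - c (target e) g)).
split=> [e | e g | M phi phiF g].
- apply/is_flow_boundary => v; rewrite !boundaryD boundaryN boundary_edge_chain.
  by rewrite !bd ?inE // root_edge; lia.
(* For a forest edge everything cancels. Otherwise both paths avoid [e], and at any other [g] each
   takes the value 0 or the same [s g], so their difference is at most 1 in absolute value. *)
- have [se0|/step->] := eqVneq (s e) 0; last by rewrite opprD addNKr addrN.
  have := sup (source e) g (in_setT _); have := sup (target e) g (in_setT _).
  rewrite /edge_chain; case: (eqVneq g e) => [->|_]; last by have := sg g; lia.
  by rewrite se0 !orbb => /eqP-> /eqP->.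
under eq_bigr do rewrite mulrzDr.
rewrite big_split /= (bigD1 g) //= /edge_chain eqxx mulr1z big1 => [|e neq]; last first.
  by rewrite eq_sym (negPf neq) mulr0z.
under [X in _ + X]eq_bigr do rewrite mulrzBr.
(* Grouped by vertex, the path terms give at each [v] the outflow minus the inflow of [phi], times
   [c v g], which is zero. *)
rewrite sumrB (partition_big (@source G) xpredT) //=.
rewrite [X in _ - X](partition_big (@target G) xpredT) //=.
rewrite addr0 -sumrB big1 ?addr0 // => v _; apply/eqP; rewrite subr_eq0; apply/eqP.
transitivity ((\sum_(e | source e == v) phi e) *~ c v g).
  by rewrite mulrz_suml; apply: eq_bigr => e /eqP->.
by rewrite phiF mulrz_suml; apply: eq_bigr => e /eqP->.
Qed.

Lemma is_flow_span (M : zmodType) (I : finType) (a : I -> M)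
    (psi : I -> edge G -> int) :
  (forall i, is_flow (psi i)) -> is_flow (fun g => \sum_i a i *~ psi i g).
Proof.
move=> psiF v; rewrite exchange_big [RHS]exchange_big /=.
by apply: eq_bigr => i _; rewrite -!mulrz_sumr psiF.
Qed.

(** Each edge end at [v] contributes at most 1; a loop has two ends there, matching its double count
    in [degree]. *)
Lemma boundary_le_degree (c : edge G -> int) v :
  (forall g, `|c g| <= 1) -> `|boundary c v| <= (degree v)%:R.
Proof.
move=> c1; apply: le_trans (ler_normB _ _) _.
rewrite /degree addnC natrD -!sum1dep_card !natr_sum.
by apply: lerD; apply: le_trans (ler_norm_sum _ _ _) _; apply: ler_sum.
Qed.

End Boundary.

Lemma is_flow_eq (M : zmodType) (G : digraph) (phi psi : edge G -> M) :
  phi =1 psi -> is_flow psi -> is_flow phi.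
Proof. by move=> eq_ psiF v; rewrite !(eq_bigr _ (fun g _ => eq_ g)). Qed.

Lemma flow_continuous_int (M : zmodType) (G H : digraph)
    (f : edge G -> edge H) : flow_continuous int f -> flow_continuous M f.
Proof.
move=> fF phi phiF; have [psi [psiF _ phiE]] := fundamental_flows H.
apply: (is_flow_eq (fun g => phiE M phi phiF (f g))).
(* The pullback of [phi] combines the pullbacks of the fundamental cycles, integer flows by
   hypothesis, with the same coefficients. *)
by apply: (is_flow_span phi (psi := fun e g => psi e (f g))) => e; apply: fF.
Qed.

(** The bound [1 < n] matters because ['Z_0] and ['Z_1] are by convention the integers modulo 2. *)
Lemma Zp_int_eq0 (n : nat) (m : int) :
  (1 < n)%N -> m%:~R = 0 :> 'Z_n -> `|m| < n%:R -> m = 0.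
Proof.
move=> n_gt1 m0 ltmn.
have {}m0 : `|m|%N%:R = 0 :> 'Z_n.
  by case: m m0 {ltmn} => // k; rewrite NegzE mulrNz abszN => /eqP;
    rewrite oppr_eq0 => /eqP.
have ltn : (`|m| < n)%N by lia.
have /= := congr1 val m0; rewrite val_Zp_nat // modn_small //; lia.
Qed.

Lemma flow_continuous_Zp (n : nat) (G H : digraph) (f : edge G -> edge H) :
    (1 < n)%N -> (max_degree G < n)%N ->
  flow_continuous 'Z_n f -> flow_continuous int f.
Proof.
move=> n_gt1 degG fF phi phiF; have [psi [psiF psi1 phiE]] := fundamental_flows H.
apply: (is_flow_eq (fun g => phiE int phi phiF (f g))).
apply: (is_flow_span phi (psi := fun e g => psi e (f g))) => e.
apply/is_flow_boundary => v; apply: (Zp_int_eq0 n_gt1); last first.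
  apply: le_lt_trans (boundary_le_degree _ _) _ => [g|]; first exact: psi1.
  by rewrite ltr_nat; apply: leq_ltn_trans degG; apply: leq_bigmax.
(* Reduced modulo [n], a fundamental cycle is a ['Z_n]-flow on [H], so the boundary of its pullback
   vanishes modulo [n]. *)
have psiZ : is_flow (fun h => (psi e h)%:~R : 'Z_n).
  by move=> u; rewrite -!rmorph_sum psiF.
by rewrite /boundary rmorphB !rmorph_sum /= -(fF _ psiZ v) subrr.
Qed.

Theorem theorem3p1 (n : nat) (n_gt3 : (3 < n)%N) (G H : digraph)
    (degG : (max_degree G < n)%N) (degH : (max_degree H < n)%N) :
  (exists f : edge G -> edge H, flow_continuous 'Z_n f) <->
  (exists f : edge G -> edge H, flow_continuous int f).
Proof.
split=> [] [f fF]; exists f; last exact: flow_continuous_int.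
exact: flow_continuous_Zp (ltnW (ltnW n_gt3)) degG fF.
Qed.
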